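(* There are absolute constants $c, C>0$ such that the following holds. Let $G$ be an abelian group and let $A \subset G$ be a non-empty finite symmetric set. Then there is a finite set $\mathcal{H}$ of subgroups of $G$ with $$|\mathcal{H}| \leq C \max\{1, M_G(A)\}$$ such that, writing $\bigcup \mathcal{H} = \bigcup_{H \in \mathcal{H}} H$, the set $A \triangle \bigcup\mathcal{H}$ is finite and either $A = \bigcup \mathcal{H}$, or $$M_G(A) \geq c\left(\log |A \triangle \textstyle\bigcup\mathcal{H}|\right)^{c}.$$
   Context: The group $G$ is regarded as discrete. A subset $A$ of $G$ is symmetric if $-x\in A$ whenever $x \in A$. $\triangle$ denotes symmetric difference. For a finite symmetric subset $A$ of $G$, let $\widehat{G}$ be the group of homomorphisms $\gamma: G \to S^1=\{z \in \mathbb{C}:|z|=1\}$, let $\widehat{1_A}(\gamma) = \sum_{x \in A}\overline{\gamma(x)}$ (which is real because $A$ is symmetric), and define $M_G(A) := \sup_{\gamma \in \widehat{G}} -\widehat{1_A}(\gamma)$. *)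

(* Defs.v *)
From HB Require Import structures.
From mathcomp Require Import all_boot all_order all_algebra.
From mathcomp Require Import finmap.
From mathcomp Require Import complex.
From mathcomp Require Import all_classical all_reals all_analysis.

Set Implicit Arguments.
Unset Strict Implicit.
Unset Printing Implicit Defensive.

Import Order.TTheory GRing.Theory Num.Theory.

Local Open Scope classical_set_scope.
Local Open Scope ring_scope.

Definition dual_group (R : realType) (G : zmodType) : set (G -> R[i]) :=
  [set gamma | (forall x, `|gamma x| = 1) /\
               (forall x y, gamma (x + y) = gamma x * gamma y)].
Arguments dual_group : clear implicits.

Definition fourier_indic (R : realType) (G : zmodType) (A : {fset G})
    (gamma : G -> R[i]) : R[i] :=
  \sum_(x <- A) (gamma x)^*.

(* [fourier_indic A gamma] is real when [A] is symmetric, so [Re] only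
   transports it from [R[i]] to [R].  The set is nonempty (trivial character)
   and bounded above by [#|` A|], so [sup] is a genuine supremum. *)
Definition MG (R : realType) (G : zmodType) (A : {fset G}) : R :=
  sup [set - complex.Re (fourier_indic A gamma) | gamma in dual_group R G].

(* Main.v *)
Require Import Defs.
From HB Require Import structures.
From mathcomp Require Import all_boot all_order all_algebra.
From mathcomp Require Import finmap.
From mathcomp Require Import complex.
From mathcomp Require Import all_classical all_reals all_analysis.
From mathcomp Require Import zify ring lra.

Set Implicit Arguments.
Unset Strict Implicit.
Unset Printing Implicit Defensive.

Import Order.TTheory GRing.Theory Num.Theory.

Local Open Scope classical_set_scope.
Local Open Scope ring_scope.

(* Averaging over characters, M_G(A) <= M says that 1_A + M * 1_{0} is positive
   semidefinite, i.e. that the Cayley graph of A has smallest eigenvalue at least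
   about -M, and Hoffman's structure theory of such graphs applies.  With d ~ M:
   a vertex has at most d^2 pairwise non-adjacent neighbours; a vertex adjacent
   to 2d^2 members of a clique is adjacent to all but 2d^2 of them; hence "every
   vertex of C is adjacent to almost all of C'" is a translation-invariant
   equivalence relation on large cliques, and at most 2d inequivalent large
   cliques pass through 0.  The translations h with C + h equivalent to C form a
   subgroup H(C), and Ramsey's theorem gives that H(C) \ A has size exp(poly M).
   Finally a set of more than exp(poly M) points of A outside the H(C) would
   contain a large clique D.  By pigeonhole D - x is equivalent to D - x0 for
   many x in D; such x - x0 lie in H(D), so are adjacent to almost all of D like
   0 is, which makes D - x0 equivalent to D, i.e. x0 in H(D), a contradiction.
   If M_G(A) < 2/5, the graph has no induced path with two edges and A is itself
   a subgroup. *)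

(** * Lists *)

(** Induct on [a + b]: keep the first element and pass to a larger class among the remaining ones. A
    list of [2 ^ (a + b)] elements always leaves half that number in one of the two classes. *)
Lemma ramsey_pairwise (T : eqType) (r : rel T) (a b : nat) (s : seq T) :
  (2 ^ (a + b) <= size s)%N ->
  exists2 t, subseq t s &
    (size t = a /\ pairwise r t) \/ (size t = b /\ pairwise (fun x y => ~~ r x y) t).
Proof.
have [n] := ubnP (a + b); elim: n a b s => // n IHn [|a] [|b] s ltn_ab szs.
1-3: by exists [::]; [exact: sub0seq|]; by [left|right].
case: s szs => [|x s] szs; first by rewrite leqn0 expn_eq0 in szs.
have szr : (size [seq y <- s | r x y] + size [seq y <- s | ~~ r x y] = size s)%N.
  by rewrite !size_filter -(count_predC (r x) s).
have : ((2 ^ (a + b.+1) <= size [seq y <- s | r x y]) ||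
        (2 ^ (a.+1 + b) <= size [seq y <- s | ~~ r x y]))%N.
  move: szs; rewrite /= [(a.+1 + b.+1)%N]addnS !addSn addnS !expnS; lia.
case/orP => /IHn.
- case; first by lia.
  move=> t st tP; have sts := subseq_trans st (filter_subseq _ _).
  case: tP => -[szt pt]; last first.
    by exists t; [exact: subseq_trans sts (subseq_cons _ _) | right].
  exists (x :: t); first by rewrite /= eqxx.
  left; split; first by rewrite /= szt.
  rewrite pairwise_cons pt andbT; apply/allP => y /(mem_subseq st).
  by rewrite mem_filter => /andP[].
- case; first by lia.
  move=> t st tP; have sts := subseq_trans st (filter_subseq _ _).
  case: tP => -[szt pt].
    by exists t; [exact: subseq_trans sts (subseq_cons _ _) | left].
  exists (x :: t); first by rewrite /= eqxx.
  right; split; first by rewrite /= szt.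
  rewrite pairwise_cons pt andbT; apply/allP => y /(mem_subseq st).
  by rewrite mem_filter => /andP[].
Qed.

Lemma exists_subseq_size (T : eqType) (s : seq T) (n : nat) :
  (n <= size s)%N -> exists2 t, subseq t s & size t = n.
Proof. by move=> ns; exists (take n s); [exact: take_subseq | rewrite size_takel]. Qed.

(* Greedy choice: every element of the chosen list discards fewer than [m] others. *)
Lemma exists_pairwise_size (T : eqType) (r : rel T) (m k : nat) (s : seq T) :
  (forall x, x \in s -> (count (r x) s <= m)%N) ->
  (k * m.+1 <= size s)%N ->
  exists2 t, subseq t s & size t = k /\ pairwise (fun x y => ~~ r x y) t.
Proof.
elim: k s => [|k IHk] s cs szs; first by exists [::]; [exact: sub0seq|].
case: s cs szs => [|x s] cs szs; first by rewrite mulSn in szs.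
have cx := cs x (mem_head _ _).
have [y ys||t st [szt pt]] := IHk [seq y <- s | ~~ r x y].
- apply: leq_trans (cs y _); last first.
    by rewrite inE; move: ys; rewrite mem_filter => /andP[_ ->]; rewrite orbT.
  by rewrite count_filter /=; apply: leq_trans (leq_addl _ _); apply: sub_count => z /andP[].
- rewrite size_filter.
  have : (count (r x) s + count (fun y => ~~ r x y) s = size s)%N := count_predC _ _.
  by move: szs cx => /=; rewrite mulSn; lia.
exists (x :: t).
  by rewrite /= eqxx; apply: subseq_trans st (filter_subseq _ _).
split; first by rewrite /= szt.
rewrite pairwise_cons pt andbT; apply/allP => y /(mem_subseq st).
by rewrite mem_filter => /andP[].
Qed.

(** If no list were maximal, the empty list could be extended past length [k]. The case of interest
    is [r] the equivalence of large cliques through 0. *)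
Lemma exists_maximal_pairwise (T : eqType) (P : T -> Prop) (r : rel T) (k : nat) :
  (forall s, {in s, forall x, P x} -> pairwise (fun x y => ~~ r x y) s -> (size s <= k)%N) ->
  exists s, [/\ {in s, forall x, P x}, pairwise (fun x y => ~~ r x y) s &
    forall x, P x -> exists2 y, y \in s & r x y].
Proof.
move=> bnd; apply: contrapT => nmax.
suff /(_ k.+1)[s [sP sr szs]] : forall n, exists s : seq T,
    [/\ {in s, forall x, P x}, pairwise (fun x y => ~~ r x y) s & size s = n].
  by have := bnd s sP sr; rewrite szs ltnn.
elim=> [|n [s [sP sr szs]]]; first by exists [::].
have [[x [Px xs]]|nex] := pselect (exists x, P x /\ {in s, forall y, ~~ r x y}).
  exists (x :: s); split; rewrite /= ?szs //.
    by move=> y; rewrite inE => /orP[/eqP->//|/sP].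
  by rewrite sr andbT; apply/allP.
case: nmax; exists s; split=> // x Px; apply: contrapT => xs.
apply: nex; exists x; split=> // y ys; apply/negP => rxy.
by apply: xs; exists y.
Qed.

Lemma size_filter_compl (T : Type) (a : pred T) (s : seq T) (p r : nat) :
  (count (fun x => ~~ a x) s <= p)%N -> (r + p <= size s)%N ->
  (r <= size [seq x <- s | a x])%N.
Proof.
by rewrite -(count_predC a) size_filter => cp rp; rewrite -(leq_add2r p);
  apply: leq_trans rp _; rewrite leq_add2l.
Qed.

Lemma size_filter_compl2 (T : Type) (a b : pred T) (s : seq T) (p q r : nat) :
  (count a s <= p)%N -> (count b s <= q)%N -> (r + p + q <= size s)%N ->
  (r <= size [seq x <- s | ~~ a x && ~~ b x])%N.
Proof.
move=> cp cq szs; apply: (@size_filter_compl _ _ _ (p + q)); last by rewrite addnA.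
apply: leq_trans (leq_add cp cq); rewrite -count_predUI.
by apply: leq_trans (leq_addr _ _); apply: sub_count => x /=; rewrite negb_and !negbK.
Qed.

Lemma count_has_le (T : Type) (U : eqType) (P : U -> pred T) (X : seq U) (s : seq T) (k : nat) :
  {in X, forall x, count (P x) s <= k}%N ->
  (count (fun y => has (P^~ y) X) s <= size X * k)%N.
Proof.
elim: X => [|x X IHX] cX; first by rewrite (eq_count (a2 := pred0)) ?count_pred0.
rewrite -[count _ _]/(count (predU (P x) (fun y => has (P^~ y) X)) s) mulSn.
apply: leq_trans (leq_add (cX x (mem_head _ _)) (IHX _)).
  by rewrite -count_predUI leq_addr.
by move=> y yX; apply: cX; rewrite inE yX orbT.
Qed.

Lemma sum_nat_of_bool (T : Type) (P : pred T) (s : seq T) :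
  (\sum_(y <- s) P y = count P s)%N.
Proof. by rewrite -sum1_count [RHS]big_mkcond; apply: eq_bigr => y _; case: (P y). Qed.

(** * Cayley graphs with bounded smallest eigenvalue *)

(** The bilinear form of the adjacency matrix (with loops if [0 \in B]) plus [e] times the identity,
    at indicator vectors counted with multiplicity. Signed weights enter only in
    [shift_form_nonneg], so values of this form are found by counting. *)
Definition shift_form (G : zmodType) (B : {fset G}) (e : nat) (S T : seq G) : nat :=
  (\sum_(x <- S) \sum_(y <- T) (((x - y)%R \in B) + e * (x == y)))%N.

(* When [0 \in B], this says that the loopless Cayley graph of [B] has smallest
   eigenvalue at least [-(e + 1)]. *)
Definition shift_form_nonneg (G : zmodType) (B : {fset G}) (e : nat) : Prop :=
  forall I : seq (int * seq G),
    0 <= \sum_(i <- I) \sum_(j <- I) i.1 * j.1 * (shift_form B e i.2 j.2)%:Z.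

Definition clique (G : zmodType) (B : {fset G}) (s : seq G) : Prop :=
  uniq s /\ {in s &, forall x y, x - y \in B}.

(* A vertex cannot be both adjacent and non-adjacent to [slack e] members of a clique. *)
Definition slack (e : nat) : nat := (2 * e.+1 ^ 2)%N.

(** The power [e.+1 ^ 4] absorbs the [slack e * slack e] members lost when passing to common
    neighbours of [slack e] vertices; the factor 10 leaves room for the eigenvalue estimate in
    [inequiv_cliques_bound]. *)
Definition clique_order (e : nat) : nat := (10 * e.+1 ^ 4)%N.

Lemma slack_clique_order (e : nat) : (0 < e)%N ->
  (slack e * slack e + 2 * slack e <= clique_order e)%N /\
  ((2 * e.+1).+1 * slack e <= clique_order e)%N.
Proof.
rewrite -(ltn_add2r 1) !addn1 /slack /clique_order; move: e.+1 => k k2.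
rewrite -[(k ^ 4)%N]/(k * (k * (k * k)))%N -[(k ^ 2)%N]/(k * k)%N.
have /leq_trans k4 : (k * k * 4 <= k * k * (k * k))%N by rewrite leq_pmul2l; nia.
by split; nia.
Qed.

Lemma clique_subseq (G : zmodType) (B : {fset G}) s t :
  subseq s t -> clique B t -> clique B s.
Proof.
move=> st [ut ct]; split; first exact: subseq_uniq st ut.
by move=> x y /(mem_subseq st) + /(mem_subseq st); apply: ct.
Qed.

Lemma clique_shift (G : zmodType) (B : {fset G}) s (h : G) :
  clique B s -> clique B [seq x + h | x <- s].
Proof.
move=> [us cs]; split; first by rewrite map_inj_uniq //; exact: addIr.
by move=> _ _ /mapP[x xs ->] /mapP[y ys ->]; rewrite opprD addrACA subrr addr0 cs.
Qed.

Definition clique_joined (G : zmodType) (B : {fset G}) (m : nat) (C : seq G) (v : G) : bool :=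
  (count (fun c => (v - c)%R \notin B) C < m)%N.

(** One-sided on its face; symmetry and transitivity are proved below for cliques with at least
    [m * m + 2 * m] members. *)
Definition clique_equiv (G : zmodType) (B : {fset G}) (m : nat) (C C' : seq G) : bool :=
  all (clique_joined B m C') C.

Definition clique_stab (G : zmodType) (B : {fset G}) (m : nat) (C : seq G) : set G :=
  [set h | clique_equiv B m [seq c + h | c <- C] C].

Lemma shift_shift (G : zmodType) (h k : G) C :
  [seq c + k | c <- [seq c + h | c <- C]] = [seq c + (h + k) | c <- C].
Proof. by rewrite -map_comp; apply: eq_map => c /=; rewrite addrA. Qed.

Lemma shift0 (G : zmodType) (C : seq G) : [seq c + 0 | c <- C] = C.
Proof. by rewrite -[RHS]map_id; apply: eq_map => c; rewrite addr0. Qed.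

Section CayleyGraph.
Variables (G : zmodType) (B : {fset G}) (e : nat).
Hypotheses (B0 : 0 \in B) (BN : {in B, forall x, - x \in B}).
Local Notation d := e.+1.
Local Notation m := (slack e).
Local Notation N := (clique_order e).
Local Notation N0 := (m * m + 2 * m)%N.
Local Notation joined := (clique_joined B m).
Local Notation equiv := (clique_equiv B m).
Local Notation stab := (clique_stab B m).

Let BC x y : (x - y \in B) = (y - x \in B).
Proof. by apply/idP/idP => /BN; rewrite opprB. Qed.

(** * Values of the form on cliques and independent sets *)

Lemma shift_formC S T : shift_form B e S T = shift_form B e T S.
Proof.
rewrite /shift_form exchange_big /=; apply: eq_bigr => y _; apply: eq_bigr => x _.
by rewrite BC eq_sym.
Qed.

Lemma shift_formE S T : shift_form B e S T =
  (\sum_(x <- S) (count (fun y => (x - y)%R \in B) T + e * count_mem x T))%N.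
Proof.
apply: eq_bigr => x _; rewrite big_split /= sum_nat_of_bool -big_distrr /=.
rewrite -(sum_nat_of_bool (pred1 x)); congr (_ + _ * _)%N.
by apply: eq_bigr => y _; rewrite /= eq_sym.
Qed.

Lemma shift_form_full S T :
  {in S & T, forall x y, x - y \in B} -> {in S, forall x, x \notin T} ->
  shift_form B e S T = (size S * size T)%N.
Proof.
move=> ST SnT; rewrite shift_formE (eq_big_seq (fun=> size T)).
  by rewrite big_const_seq count_predT iter_addn_0 mulnC.
move=> x xS; rewrite (count_memPn (SnT x xS)) muln0 addn0.
by apply/eqP; rewrite -all_count; apply/allP => y; apply: ST.
Qed.

Lemma shift_form_clique S : clique B S ->
  shift_form B e S S = (size S * (size S + e))%N.
Proof.
case=> uS cS; rewrite shift_formE (eq_big_seq (fun=> (size S + e)%N)).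
  by rewrite big_const_seq count_predT iter_addn_0 mulnC.
move=> x xS; rewrite count_uniq_mem // xS muln1; congr addn.
by apply/eqP; rewrite -all_count; apply/allP => y; apply: cS.
Qed.

Lemma shift_form_indep S : uniq S -> {in S &, forall x y, x - y \in B -> x = y} ->
  shift_form B e S S = (size S * e.+1)%N.
Proof.
move=> uS cS; rewrite shift_formE (eq_big_seq (fun=> e.+1)).
  by rewrite big_const_seq count_predT iter_addn_0 mulnC.
move=> x xS; rewrite count_uniq_mem // xS muln1.
rewrite (@eq_in_count _ _ (pred1 x)) ?count_uniq_mem ?xS ?add1n //.
by move=> y yS /=; apply/idP/eqP => [/(cS _ _ xS yS)->//|->]; rewrite subrr.
Qed.

Lemma shift_form_far S T : {in S & T, forall x y, x - y \notin B} ->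
  shift_form B e S T = 0%N.
Proof.
move=> ST; rewrite /shift_form big_seq big1 // => x xS.
rewrite big_seq big1 // => y yT; rewrite (negbTE (ST x y xS yT)).
by case: eqP => [xy|_]; [move: (ST x y xS yT); rewrite xy subrr B0 | rewrite muln0].
Qed.

Lemma shift_form1 v : shift_form B e [:: v] [:: v] = e.+1.
Proof. by rewrite /shift_form !big_seq1 subrr B0 eqxx muln1 add1n. Qed.

(** * Forbidden configurations *)

Hypothesis Bpos : shift_form_nonneg B e.
Hypothesis e_gt0 : (0 < e)%N.

(* The smallest eigenvalue of a star with [t] leaves is [- sqrt t]. *)
Lemma star_bound v T : uniq T -> {in T, forall y, v - y \in B} ->
  {in T &, forall x y, x - y \in B -> x = y} -> (size T <= d ^ 2)%N.
Proof.
move=> uT vT iT; rewrite leqNgt; apply/negP => szT.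
have vnT : v \notin T.
  apply/negP => vinT; suff : (size T <= 1)%N.
    by move: szT; rewrite -[(2%N)]/(1.+1) expnS expn1; lia.
  rewrite -[1%N]/(size [:: v]); apply: uniq_leq_size => // y yT.
  by rewrite inE -(iT v y vinT yT (vT y yT)).
have vTf : shift_form B e [:: v] T = size T.
  by rewrite shift_form_full ?mul1n // => [x y|x]; rewrite inE => /eqP->; [exact: vT|].
(* With weight [- d] on the leaves, weight [size T] at the centre minimises the form. *)
have := Bpos [:: ((size T)%:Z, [:: v]); (- (d%:Z), T)].
rewrite !big_cons !big_nil /= shift_form1 (shift_formC T) vTf shift_form_indep //.
rewrite leNgt => /negP; apply.
move: szT; set t := size T; rewrite -[(d ^ 2)%N]/(d * d)%N => szT.
have -> : t%:Z * t%:Z * d%:Z + (t%:Z * - d%:Z * t%:Z + 0) +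
  (- d%:Z * t%:Z * t%:Z + (- d%:Z * - d%:Z * (t * d)%N%:Z + 0) + 0) =
  - (d%:Z * t%:Z * (t%:Z - d%:Z * d%:Z)) by rewrite PoszM; ring.
rewrite oppr_lt0 !mulr_gt0 ?subr_gt0 // ?ltz_nat //.
by case: (t) szT => //; rewrite ltn0.
Qed.

(* Hoffman's forbidden configuration: no vertex is joined to exactly half of a
   large clique. *)
Lemma no_half_joined_clique v X D : clique B X -> clique B D ->
  {in X & D, forall x y, x - y \in B} ->
  {in X, forall x, v - x \in B} -> {in D, forall x, v - x \notin B} ->
  (m <= size X)%N -> (size D < m)%N.
Proof.
move=> + + + + + /exists_subseq_size[X' sX szX']; rewrite ltnNge => cX cD XD vX vD.
apply/negP => /exists_subseq_size[D' sD szD'].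
have {}cX := clique_subseq sX cX.
have {}cD := clique_subseq sD cD.
have {}XD : {in X' & D', forall x y, x - y \in B}.
  by move=> x y /(mem_subseq sX) + /(mem_subseq sD); apply: XD.
have {}vX : {in X', forall x, v - x \in B} by move=> x /(mem_subseq sX)/vX.
have {}vD : {in D', forall x, v - x \notin B} by move=> x /(mem_subseq sD)/vD.
have m_gt0 : (0 < m)%N by rewrite muln_gt0 expn_gt0.
have vnX : v \notin X'.
  case: D' szD' vD XD {sD cD} => [sz0|y D' _ vD XD]; first by rewrite -sz0 in m_gt0.
  by apply/negP => vX'; have := vD y (mem_head _ _); rewrite XD ?mem_head.
have XnD : {in X', forall x, x \notin D'}.
  by move=> x /vX vx; apply/negP => /vD; rewrite vx.
have vXf : shift_form B e [:: v] X' = m.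
  by rewrite shift_form_full ?mul1n // => [x y|x]; rewrite inE => /eqP->; [exact: vX|].
have vDf : shift_form B e [:: v] D' = 0%N.
  by rewrite shift_form_far // => x y; rewrite inE => /eqP->; exact: vD.
have XDf : shift_form B e X' D' = (m * m)%N by rewrite shift_form_full // szX' szD'.
(* The signs on [X'] and [D'] cancel their terms of order [m ^ 2]. The weight [m / d = 2 * d] at [v]
   minimises the rest. *)
have := Bpos [:: ((2 * d)%N%:Z, [:: v]); (- 1, X'); (1, D')].
rewrite !big_cons !big_nil /= shift_form1 (shift_formC _ [:: v]) (shift_formC D' _).
rewrite (shift_formC D' _) vXf vDf XDf !shift_form_clique // szX' szD' leNgt => /negP; apply.
rewrite [X in X < _](_ : _ = - 4 * d%:Z ^+ 2); first by nia.
have eE : e%:Z = d%:Z - 1 by lia.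
rewrite !PoszM !PoszD /slack !PoszM eE; ring.
Qed.

Let m_gt0 : (0 < m)%N. Proof. by rewrite muln_gt0 expn_gt0. Qed.

(** Otherwise the neighbours and the non-neighbours of [v] in [C] form the forbidden configuration.
    So a vertex is adjacent either to almost all of a clique or to almost none of it. *)
Lemma count_not_joined C v : clique B C -> ~~ joined C v ->
  (count (fun c => v - c \in B)%R C < m)%N.
Proof.
move=> cC; rewrite /clique_joined -leqNgt -!size_filter => szD.
rewrite ltnNge; apply/negP => szX; move: szD; rewrite leqNgt => /negP; apply.
apply: (@no_half_joined_clique v [seq c <- C | v - c \in B]) => //.
- exact: clique_subseq (filter_subseq _ _) cC.
- exact: clique_subseq (filter_subseq _ _) cC.
- by move=> x y; rewrite !mem_filter => /andP[_ xC] /andP[_ yC]; apply: cC.2.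
- by move=> x; rewrite mem_filter => /andP[].
- by move=> x; rewrite mem_filter => /andP[].
Qed.

(** * Equivalence of large cliques *)

Lemma count_not_common X C : {in X, forall x, joined C x} ->
  (count (fun c => has (fun x => (x - c)%R \notin B) X) C <= size X * m)%N.
Proof.
by move=> jX; apply: count_has_le => x /jX/ltnW.
Qed.

(** Take [m] members of [X]. If [v] is not joined to [C], discard from [C] the at most [m * m]
    members missed by some chosen member of [X] and the fewer than [m] neighbours of [v]. By the
    choice of [N0], at least [m] members remain, which with [X] and [v] form the forbidden
    configuration. *)
Lemma joined_of_clique X C v : clique B X -> clique B C -> (N0 <= size C)%N ->
  (m <= size X)%N -> {in X, forall x, v - x \in B} -> {in X, forall x, joined C x} ->
  joined C v.
Proof.
move=> + cC szC /exists_subseq_size[X' sX szX'] + + => cX vX jX.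
have {cX}cX := clique_subseq sX cX.
have {}vX : {in X', forall x, v - x \in B} by move=> x /(mem_subseq sX)/vX.
have {}jX : {in X', forall x, joined C x} by move=> x /(mem_subseq sX)/jX.
apply/negPn/negP => njv; have cv := count_not_joined cC njv.
have := count_not_common jX; rewrite szX' => cc.
pose D := [seq c <- C | ~~ has (fun x => (x - c)%R \notin B) X' && ~~ (v - c \in B)].
have szD : (m <= size D)%N.
  by apply: size_filter_compl2 cc (ltnW cv) _; apply: leq_trans szC; lia.
move: szD; rewrite leqNgt => /negP; apply.
apply: (no_half_joined_clique cX (v := v)); rewrite ?szX' //.
- exact: clique_subseq (filter_subseq _ _) cC.
- move=> x y xX; rewrite mem_filter => /andP[/andP[/hasPn/(_ x xX)]].
  by rewrite negbK.
- by move=> y; rewrite mem_filter => /andP[/andP[]].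
Qed.

Lemma joined_equiv C C' v : clique B C -> clique B C' ->
  (N0 <= size C)%N -> (N0 <= size C')%N -> joined C v -> equiv C C' -> joined C' v.
Proof.
move=> cC cC' szC szC' jv /allP CC'.
apply: (@joined_of_clique [seq c <- C | v - c \in B]) => //.
- exact: clique_subseq (filter_subseq _ _) cC.
- by apply: size_filter_compl (ltnW jv) _; apply: leq_trans szC; lia.
- by move=> x; rewrite mem_filter => /andP[].
- by move=> x; rewrite mem_filter => /andP[_ /CC'].
Qed.

(** The members of [C] joined to [C'] form a clique adjacent to every vertex of [C], so
    [joined_of_clique] spreads the property to all of [C]. *)
Lemma clique_equiv_of_count C C' : clique B C -> clique B C' ->
  (N0 <= size C')%N -> (m <= count (joined C') C)%N -> equiv C C'.
Proof.
move=> cC cC' szC' szX; apply/allP => x xC.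
apply: (@joined_of_clique [seq c <- C | joined C' c]) => //.
- exact: clique_subseq (filter_subseq _ _) cC.
- by rewrite size_filter.
- by move=> y; rewrite mem_filter => /andP[_ yC]; apply: cC.2.
- by move=> y; rewrite mem_filter => /andP[].
Qed.

Lemma clique_equiv_sub C C' : clique B C' -> {subset C <= C'} -> equiv C C'.
Proof.
move=> cC' CC'; apply/allP => x /CC' xC'.
rewrite /clique_joined (eq_in_count (a2 := pred0)) ?count_pred0 //.
by move=> y yC /=; rewrite cC'.2.
Qed.

Lemma clique_equiv_refl C : clique B C -> equiv C C.
Proof. by move=> cC; apply: clique_equiv_sub. Qed.

(** If [y] in [C'] missed [m] members of [C], these would have at least [m] common neighbours in
    [C'], all adjacent to [y]: the forbidden configuration again. *)
Lemma clique_equiv_sym C C' : clique B C -> clique B C' ->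
  (N0 <= size C')%N -> equiv C C' -> equiv C' C.
Proof.
move=> cC cC' szC' /allP CC'; apply/allP => y yC'; rewrite /clique_joined ltnNge -size_filter.
apply/negP => /exists_subseq_size[X sX szX].
have jX : {in X, forall x, joined C' x}.
  by move=> x /(mem_subseq sX); rewrite mem_filter => /andP[_ /CC'].
have := count_not_common jX; rewrite szX => cc.
pose D := [seq c <- C' | ~~ has (fun x => (x - c)%R \notin B) X].
have szD : (m <= size D)%N.
  apply: (@size_filter_compl _ _ _ (m * m)); last by apply: leq_trans szC'; lia.
  by apply: leq_trans cc; apply: sub_count => c /=; rewrite negbK.
suff : (size X < m)%N by rewrite szX ltnn.
apply: (no_half_joined_clique _ _ (v := y) _ _ _ szD).
- exact: clique_subseq (filter_subseq _ _) cC'.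
- exact: clique_subseq (subseq_trans sX (filter_subseq _ _)) cC.
- move=> c x; rewrite mem_filter => /andP[/hasPn + _] xX => /(_ x xX).
  by rewrite negbK BC.
- by move=> c; rewrite mem_filter => /andP[_ cC'']; apply: cC'.2.
- by move=> x /(mem_subseq sX); rewrite mem_filter => /andP[].
Qed.

Lemma clique_equiv_trans C C' C'' : clique B C' -> clique B C'' ->
  (N0 <= size C')%N -> (N0 <= size C'')%N -> equiv C C' -> equiv C' C'' -> equiv C C''.
Proof.
by move=> cC' cC'' sz' sz'' /allP CC' CC''; apply/allP => x /CC' /joined_equiv; apply.
Qed.

(** * Translates and stabilisers of cliques *)

Lemma joined_shift h C v : joined [seq c + h | c <- C] (v + h) = joined C v.
Proof.
rewrite /clique_joined count_map; congr (_ < _)%N; apply: eq_count => c /=.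
by rewrite opprD addrACA subrr addr0.
Qed.

Lemma clique_equiv_shift h C C' :
  equiv [seq c + h | c <- C] [seq c + h | c <- C'] = equiv C C'.
Proof. by rewrite /clique_equiv all_map; apply: eq_all => v /=; rewrite joined_shift. Qed.

Lemma clique_stab_zmod_closed C : clique B C -> (N0 <= size C)%N ->
  zmod_closed (mem (stab C)).
Proof.
move=> cC szC; split=> [|x y]; rewrite !inE /clique_stab /=.
  by rewrite shift0 clique_equiv_refl.
move=> xC yC; apply: (@clique_equiv_trans _ [seq c - y | c <- C]) => //;
  rewrite ?size_map //; try exact: clique_shift.
- by rewrite -shift_shift clique_equiv_shift.
- rewrite -(clique_equiv_shift y) shift_shift addNr shift0.
  by apply: clique_equiv_sym; rewrite ?size_map //; exact: clique_shift.
Qed.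

Lemma clique_stab_equiv C C' : clique B C -> clique B C' ->
  (N0 <= size C)%N -> (N0 <= size C')%N -> equiv C C' -> stab C `<=` stab C'.
Proof.
move=> cC cC' szC szC' CC' h; rewrite /clique_stab /= => hC.
have C'C := clique_equiv_sym cC cC' szC' CC'.
apply: (@clique_equiv_trans _ [seq c + h | c <- C]); rewrite ?size_map //.
- exact: clique_shift.
- by rewrite clique_equiv_shift.
- exact: clique_equiv_trans CC'.
Qed.

(** Translating by [h], the vertex [h] is joined to [C + h], and equivalence carries this over to
    [C]. *)
Lemma joined_clique_stab C h : clique B C -> (N0 <= size C)%N ->
  joined C 0 -> stab C h -> joined C h.
Proof.
move=> cC szC j0 hC; rewrite -[h]add0r; apply: (joined_equiv _ _ _ _ _ hC) => //.
- exact: clique_shift.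
- by rewrite size_map.
- by rewrite joined_shift.
Qed.

(** At most [m] members of [C] are joined to [C'], by [clique_equiv_of_count]; each of the others
    has fewer than [m] neighbours in [C']. *)
Lemma shift_form_inequiv C C' : clique B C -> clique B C' -> size C = size C' ->
  (N0 <= size C')%N -> ~~ equiv C C' ->
  (shift_form B e C C' <= size C * (2 * m + e))%N.
Proof.
move=> cC cC' szCC' szC' nCC'; rewrite shift_formE.
have : (count (joined C') C <= m)%N.
  rewrite leqNgt; apply: contra nCC' => /ltnW; exact: clique_equiv_of_count.
move=> cj; apply: (@leq_trans (\sum_(x <- C) ((m + e) + size C * joined C' x))%N).
  rewrite !big_seq; apply: leq_sum => x xC.
  have cx : (e * count_mem x C' <= e)%N.
    by rewrite count_uniq_mem ?cC'.1 // -{2}(muln1 e) leq_mul2l leq_b1 orbT.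
  have [jx|njx] := boolP (joined C' x).
    rewrite muln1 addnC leq_add //; last by rewrite szCC' count_size.
    exact: leq_trans cx (leq_addl _ _).
  by rewrite muln0 addn0 leq_add //; exact/ltnW/count_not_joined.
rewrite big_split /= -big_distrr /= sum_nat_of_bool big_const_seq count_predT iter_addn_0.
by rewrite mulnC -mulnDr leq_mul2l; apply/orP; right; lia.
Qed.

(* The smallest eigenvalue of a vertex lying in [t] large, almost
   non-adjacent cliques is about [- t]. *)
Lemma inequiv_cliques_bound cs :
  {in cs, forall C, [/\ clique B C, 0 \in C & size C = N]} ->
  pairwise (fun C C' => ~~ equiv C C') cs -> (size cs <= 2 * d)%N.
Proof.
move=> csP cs_ineq; have [N0N _] := slack_clique_order e_gt0.
have form_cs : (\sum_(C <- cs) \sum_(C' <- cs) shift_form B e C C' <=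
    size cs * (N * (N + e)) + size cs ^ 2 * (N * (2 * m + e)))%N.
  elim: cs csP cs_ineq => [|C cs IHcs] csP; first by rewrite big_nil.
  rewrite pairwise_cons => /andP[/allP Ccs /IHcs {}IHcs].
  have [cC C0 szC] := csP C (mem_head _ _).
  have cscsP : {in cs, forall C, [/\ clique B C, 0 \in C & size C = N]}.
    by move=> C' C'cs; apply: csP; rewrite inE C'cs orbT.
  have sumC : (\sum_(C' <- cs) shift_form B e C C' <= size cs * (N * (2 * m + e)))%N.
    rewrite mulnC -iter_addn_0 -count_predT -big_const_seq !big_seq.
    apply: leq_sum => C' C'cs; have [cC' _ szC'] := cscsP C' C'cs.
    by rewrite -{1}szC shift_form_inequiv ?szC' ?Ccs.
  rewrite big_cons big_cons shift_form_clique // szC.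
  rewrite [X in (_ + X <= _)%N](eq_bigr (fun C' => (shift_form B e C C' +
    \sum_(j <- cs) shift_form B e C' j)%N)); last by move=> C' _; rewrite big_cons shift_formC.
  rewrite big_split /= -addnA mulSn -addnA leq_add2l; move: sumC (IHcs cscsP).
  rewrite -[((size cs).+1 ^ 2)%N]/((size cs).+1 * (size cs).+1)%N.
  rewrite -[(size cs ^ 2)%N]/((size cs) * (size cs))%N.
  move: (N * (2 * m + e))%N (N * (N + e))%N => b b'.
  have arith (s S t : nat) : (s <= t * b -> S <= t * b' + t * t * b ->
    s + (s + S) <= t * b' + t.+1 * t.+1 * b)%N by nia.
  exact: arith.
have form0 C : C \in cs -> shift_form B e [:: 0] C = (N + e)%N.
  move=> /csP[cC C0 szC]; rewrite shift_formE big_seq1 count_uniq_mem ?cC.1 // C0 muln1.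
  congr addn; rewrite -szC; apply/eqP; rewrite -all_count; apply/allP => y.
  exact: cC.2.
rewrite leqNgt; apply/negP => szcs.
(* The minimising weight [size cs * N / d], an integer by the choice of [N]. *)
pose a := (10 * size cs * d ^ 3)%N.
have := Bpos ((a%:Z, [:: 0]) :: [seq (-1, C) | C <- cs]).
rewrite big_cons big_cons !big_map /= shift_form1 //.
have constE (c : int) : \sum_(C <- cs) c = c * (size cs)%:Z.
  by rewrite big_const_seq count_predT iter_addr_0 -mulr_natr natz.
rewrite [X in _ + X + _](_ : _ = - (a * (N + e))%N%:Z * (size cs)%:Z); last first.
  rewrite -constE; apply: eq_big_seq => C /form0->.
  by rewrite PoszM mulrN1 mulNr.
rewrite [X in _ + _ + X](_ : _ = - (a * (N + e))%N%:Z * (size cs)%:Z +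
    (\sum_(C <- cs) \sum_(C' <- cs) shift_form B e C C')%N%:Z); last first.
  rewrite -constE (big_morph _ PoszD (erefl _)) -big_split /=; apply: eq_big_seq => C Ccs.
  rewrite big_cons big_map /= shift_formC // form0 // PoszM mulN1r mulNr; congr (_ + _).
  rewrite (big_morph _ PoszD (erefl _)); apply: eq_bigr => C' _.
  by rewrite mulrNN !mul1r.
apply/negP; rewrite -ltNge.
move: form_cs szcs; move: (\sum_(C <- cs) \sum_(C' <- cs) shift_form B e C C')%N (size cs) @a.
move=> F t a FF szcs.
(* After division by [10 * t * d ^ 3] the main terms are [10 * d ^ 5] against [10 * t * d ^ 4]. The
   overlaps of distinct cliques cost at most [3 * t * d ^ 4], which [t > 2 * d] can afford. *)
suff : (a * a * d + F < 2 * (a * (N + e) * t))%N by rewrite !PoszM; lia.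
apply: leq_ltn_trans (leq_add (leqnn _) FF) _; rewrite /a /clique_order /slack.
have -> : (10 * t * d ^ 3 * (10 * t * d ^ 3) * d + (t * (10 * d ^ 4 * (10 * d ^ 4 + e)) +
    t ^ 2 * (10 * d ^ 4 * (2 * (2 * d ^ 2) + e))) =
  10 * t * d ^ 3 * (10 * t * d ^ 4 + d * (10 * d ^ 4 + e) + t * d * (4 * d ^ 2 + e)))%N by ring.
have -> : (2 * (10 * t * d ^ 3 * (10 * d ^ 4 + e) * t) =
  10 * t * d ^ 3 * (20 * t * d ^ 4 + 2 * t * e))%N by ring.
rewrite ltn_pmul2l ?muln_gt0 ?expn_gt0 ?andbT //=; last exact: leq_ltn_trans szcs.
have d2 : (2 <= d)%N by [].
have ed : (e <= d)%N by [].
move: (d) d2 ed szcs => k k2 ek tk.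
have e1 : (4 * (t * (k * (k * k))) <= 2 * (t * (k * (k * (k * k)))))%N by nia.
have k0 : (0 < k)%N by exact: ltnW.
have e0 : (e <= k * (k * k))%N by rewrite (leq_trans ek) // leq_pmulr // muln_gt0 k0.
have e2 : (t * k * e <= t * (k * (k * (k * k))))%N.
  by rewrite [X in (_ <= X)%N]mulnA leq_mul2l e0 orbT.
have e3 : (2 * k * (k * (k * (k * k))) + k * (k * (k * k)) <= t * (k * (k * (k * k))))%N.
  by rewrite -[X in (_ + X <= _)%N]mul1n -mulnDl leq_mul2r addn1 tk orbT.
have e4 : (k * e <= k * (k * (k * k)))%N by rewrite leq_mul2l e0 orbT.
have e5 : (0 < k * (k * (k * k)))%N by rewrite !muln_gt0 k0.
rewrite -[(k ^ 4)%N]/(k * (k * (k * k)))%N -[(k ^ 2)%N]/(k * k)%N.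
lia.
Qed.

(** * Consequences of Ramsey's theorem *)

Lemma clique_or_indep k s : uniq s -> (2 ^ (k + (d ^ 2).+1) <= size s)%N ->
  exists2 t, subseq t s & (clique B t /\ size t = k) \/
    (size t = (d ^ 2).+1 /\ {in t &, forall x y, x - y \in B -> x = y}).
Proof.
move=> us /(ramsey_pairwise (fun x y => x - y \in B))[t st tP]; exists t => //.
have ut := subseq_uniq st us.
case: tP => -[szt pt]; [left|right]; split=> //.
- split=> //; move: pt; rewrite pairwise_all2rel.
  + by move=> /allrelP.
  + by move=> x; rewrite subrr.
  + by move=> x y; exact: BC.
- have : pairwise (fun x y => (x - y \in B) ==> (x == y)) t.
    by apply: sub_pairwise pt => x y /negbTE ->.
  rewrite pairwise_all2rel => [|x|x y]; last by rewrite BC eq_sym.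
    by move=> /allrelP it x y xt yt xy; apply/eqP/(implyP (it x y xt yt)).
  by rewrite eqxx implybT.
Qed.

(** The independent alternative has [d ^ 2 + 1] elements, one more than [star_bound] allows among
    neighbours of [v]. *)
Lemma clique_or_star k v s : uniq s -> {in s, forall x, v - x \in B} ->
  (2 ^ (k + (d ^ 2).+1) <= size s)%N ->
  exists2 t, subseq t s & clique B t /\ size t = k.
Proof.
move=> us vs /(clique_or_indep us)[t st [tP|[szt it]]]; first by exists t.
have vt : {in t, forall x, v - x \in B} by move=> x /(mem_subseq st)/vs.
have := star_bound (subseq_uniq st us) vt it.
by rewrite szt ltnn.
Qed.

(** This bounds the part of a stabiliser outside [B]. A clique of [m] such points, with its common
    neighbours in [C], is forbidden by the vertex 0, which is adjacent to the latter only. If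
    instead [d ^ 2 + 1 <= m] of them are independent, they have a common neighbour in [C],
    contradicting [star_bound]. *)
Lemma joined_far_bound C s : clique B C -> (N0 <= size C)%N -> 0 \in C ->
  uniq s -> {in s, forall x, joined C x /\ x \notin B} ->
  (size s < 2 ^ (m + (d ^ 2).+1))%N.
Proof.
move=> cC szC C0 us sP; rewrite ltnNge; apply/negP => /(clique_or_indep us)[t st tP].
have jt : {in t, forall x, joined C x} by move=> x /(mem_subseq st)/sP[].
have tB : {in t, forall x, x \notin B} by move=> x /(mem_subseq st)/sP[].
have := count_not_common jt.
case: tP => [[ct szt]|[szt it]]; rewrite szt => cc.
- pose D := [seq c <- C | ~~ has (fun x => (x - c)%R \notin B) t].
  have szD : (m <= size D)%N.
    apply: (@size_filter_compl _ _ _ (m * m)); last by apply: leq_trans szC; lia.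
    by apply: leq_trans cc; apply: sub_count => c /=; rewrite negbK.
  suff : (size t < m)%N by rewrite szt ltnn.
  apply: (no_half_joined_clique _ ct (v := 0) _ _ _ szD).
  + exact: clique_subseq (filter_subseq _ _) cC.
  + move=> c x; rewrite mem_filter => /andP[/hasPn + _] xX => /(_ x xX).
    by rewrite negbK BC.
  + by move=> c; rewrite mem_filter => /andP[_]; apply: cC.2.
  + by move=> x /tB; rewrite BC subr0.
- have [c cC' /hasPn ct] : exists2 c, c \in C & ~~ has (fun x => (x - c)%R \notin B) t.
    apply/hasP; rewrite has_count; have {}cc := leq_trans cc.
    rewrite -size_filter; apply: (@size_filter_compl _ _ _ (m * m)).
      apply: leq_trans (cc (m * m)%N _); first by apply: sub_count => c /=; rewrite negbK.
      by rewrite leq_mul2r -[(d ^ 2).+1]addn1 [X in (_ <= X)%N]/slack mul2n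
         -addnn leq_add2l expn_gt0 orbT.
    by apply: leq_trans szC; rewrite addnC leq_add2l muln_gt0 muln_gt0 expn_gt0.
  have ct' : {in t, forall x, c - x \in B} by move=> x /ct; rewrite negbK BC.
  have := star_bound (subseq_uniq st us) ct' it.
  by rewrite szt ltnn.
Qed.

Lemma clique_stab_cover : exists cs : seq (seq G),
  [/\ (size cs <= 2 * d)%N,
    {in cs, forall C, [/\ clique B C, 0 \in C & size C = N]} &
    forall s : seq G, uniq s ->
      {in s, forall x, x \in B /\ {in cs, forall C, ~ stab C x}} ->
      (size s < 2 ^ (N + (d ^ 2).+1))%N].
Proof.
have [N0N mN] := slack_clique_order e_gt0.
pose P (C : seq G) := [/\ clique B C, 0 \in C & size C = N].
have Pbnd s : {in s, forall C, P C} -> pairwise (fun C C' => ~~ equiv C C') s ->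
  (size s <= 2 * d)%N by exact: inequiv_cliques_bound.
have [cs [csP cs_ineq cs_max]] := exists_maximal_pairwise Pbnd.
exists cs; split=> //; first exact: Pbnd.
move=> s us sP; rewrite ltnNge; apply/negP => szs.
have [|D sD [cD szD]] := clique_or_star us (v := 0) _ szs.
  by move=> x /sP[xB _]; rewrite sub0r BN.
have {sP}DP x : x \in D -> x \in B /\ {in cs, forall C, ~ stab C x}.
  by move=> /(mem_subseq sD)/sP.
have N0D : (N0 <= size D)%N by rewrite szD.
pose sh x := [seq c - x | c <- D].
have csh x : clique B (sh x) by exact: clique_shift.
have N0sh x : (N0 <= size (sh x))%N by rewrite size_map szD.
have Psh x : x \in D -> P (sh x).
  by move=> xD; split; rewrite // ?size_map ?szD //; apply/mapP; exists x; rewrite ?subrr.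
(* Pigeonhole: if each translate were equivalent to at most [m.-1] of them, greedy choice would give
   [2 * d + 1] inequivalent ones, since [(2 * d + 1) * m <= N]. *)
have [x0 x0D szx0] : exists2 x, x \in D & (m <= count (fun y => equiv (sh x) (sh y)) D)%N.
  apply: contrapT => nx.
  have [| |t tD [szt tP]] :=
      @exists_pairwise_size _ (fun x y => equiv (sh x) (sh y)) m.-1 (2 * d).+1 D.
  - move=> x xD; rewrite -ltnS prednK ?muln_gt0 ?expn_gt0 // ltnNge.
    by apply/negP => mx; apply: nx; exists x.
  - by rewrite prednK ?muln_gt0 ?expn_gt0 // szD.
  have := Pbnd [seq sh x | x <- t]; rewrite size_map szt ltnn pairwise_map.
  move=> /(_ _ tP) abs; suff: false by []; apply: abs.
  by move=> _ /mapP[x /(mem_subseq tD)/Psh + ->].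
have jD0 : joined D 0.
  rewrite /clique_joined (eq_in_count (a2 := pred0)) ?count_pred0 ?muln_gt0 ?expn_gt0 //.
  by move=> y /DP[yB _]; rewrite /= sub0r BN.
have stabD y : equiv (sh x0) (sh y) -> stab D (y - x0).
  rewrite -(clique_equiv_shift y) !shift_shift addNr shift0 /clique_stab /=.
  by rewrite addrC.
have shD : equiv (sh x0) D.
  apply: clique_equiv_of_count => //.
  rewrite count_map; apply: leq_trans szx0 _; apply: sub_count => y /stabD.
  exact: joined_clique_stab.
have [C Ccs shC] := cs_max _ (Psh _ x0D).
have [cC C0 szC] := csP C Ccs.
have N0C : (N0 <= size C)%N by rewrite szC.
(* Since [D] is equivalent to [D - x0], the point [x0] stabilises [D]. Both are equivalent to [C],
   so [x0] also stabilises [C], against the choice of [s]. *)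
case: (DP _ x0D) => _ /(_ C Ccs); apply.
have Dsh : equiv D (sh x0) by apply: clique_equiv_sym.
apply: (clique_stab_equiv cD) => //.
  exact: clique_equiv_trans shC.
by rewrite /clique_stab /= -(clique_equiv_shift (- x0)) shift_shift subrr shift0.
Qed.

End CayleyGraph.

(** * Characters *)

Section Characters.
Variables (R : realType) (G : zmodType).
Implicit Types Gam : set (G * R[i]).

(* Graphs of homomorphisms from a subgroup of [G] to the unit circle; the empty
   set is allowed, since Zorn's lemma asks for the union of the empty chain. *)
Definition partial_char Gam : Prop :=
  [/\ forall p q, Gam p -> Gam q -> Gam (p.1 - q.1, p.2 / q.2),
      forall p, Gam p -> `|p.2| = 1 &
      forall a, Gam (0, a) -> a = 1].

(** Only [a = 1] needs care: there [b] is taken as a root of [1 + X + ... + X^(n-1)], whose value at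
    1 is [n]. *)
Lemma exists_root_neq1 (n : nat) (a : R[i]) : (1 < n)%N -> `|a| = 1 ->
  exists b : R[i], [/\ b ^+ n = a, b != 1 & `|b| = 1].
Proof.
move=> n1 a1; have norm_b (b : R[i]) : b ^+ n = a -> `|b| = 1.
  move=> ba; have := a1; rewrite -ba normrX => /eqP.
  by rewrite pexpr_eq1 ?(ltnW n1) // => /eqP.
have [a_eq1|a_neq1] := eqVneq a 1.
  have /closed_rootP[b] : size (\poly_(i < n) (1 : R[i])) != 1.
    by rewrite size_poly_eq ?oner_eq0 //; case: n n1 {norm_b} => [|[]].
  rewrite rootE horner_poly; under eq_bigr do rewrite mul1r.
  move=> /eqP sb; have bn : b ^+ n = a.
    by apply/eqP; rewrite a_eq1 -subr_eq0 subrX1 sb mulr0.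
  exists b; split=> //; last exact: norm_b.
  apply/eqP => b1; move: sb; rewrite b1.
  under eq_bigr do rewrite expr1n.
  rewrite sumr_const card_ord => /eqP; rewrite pnatr_eq0.
  by case: n n1 {norm_b bn}.
have /closed_rootP[b] : size ('X^n - a%:P) != 1.
  by rewrite size_XnsubC ?(ltnW n1) //; case: n n1 {norm_b}.
rewrite rootE !hornerE subr_eq0 => /eqP bn; exists b; split=> //; last exact: norm_b.
by apply/eqP => b1; move: a_neq1; rewrite -bn b1 expr1n eqxx.
Qed.

Section PartialChar.
Variable Gam : set (G * R[i]).
Hypotheses (GamP : partial_char Gam) (Gam0 : Gam !=set0).

Lemma partial_char_neq0 p : Gam p -> p.2 != 0.
Proof. by have [_ Gn _] := GamP => /Gn p1; rewrite -normr_eq0 p1 oner_eq0. Qed.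

Lemma partial_char1 : Gam (0, 1).
Proof.
have [Gs _ _] := GamP; have [p pG] := Gam0; have := Gs p p pG pG.
by rewrite subrr divff // partial_char_neq0.
Qed.

Lemma partial_charN x a : Gam (x, a) -> Gam (- x, a^-1).
Proof.
by have [Gs _ _] := GamP; move=> /(Gs _ _ partial_char1); rewrite /= sub0r div1r.
Qed.

Lemma partial_charD x a y b : Gam (x, a) -> Gam (y, b) -> Gam (x + y, a * b).
Proof.
have [Gs _ _] := GamP; move=> xa /partial_charN /(Gs _ _ xa).
by rewrite /= opprK invrK.
Qed.

Lemma partial_charMz x a (n : int) : Gam (x, a) -> Gam (x *~ n, a ^ n).
Proof.
move=> xa; have pos k : Gam (x *+ k, a ^+ k).
  elim: k => [|k IHk]; first exact: partial_char1.
  by rewrite mulrS exprS; exact: partial_charD.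
case: n => n; first exact: pos.
by rewrite NegzE mulrNz -invr_expz; exact/partial_charN/(pos n.+1).
Qed.

Lemma partial_char_inj x a b : Gam (x, a) -> Gam (x, b) -> a = b.
Proof.
have [Gs _ G1] := GamP; move=> xa xb; have := Gs _ _ xa xb.
rewrite /= subrr => /G1 /divr1_eq; exact.
Qed.

(** The value [b] at [g] must agree with the values already assigned to multiples of [g]. If no
    positive multiple is in the domain, [-1] will do. Otherwise let [n0 > 1] be the least one: every
    multiple in the domain is a multiple of [g *+ n0], so an [n0]-th root suffices. *)
Lemma partial_char_extend g : (forall a, ~ Gam (g, a)) ->
  exists b Gam', [/\ b != 1, partial_char Gam', Gam `<=` Gam' & Gam' (g, b)].
Proof.
move=> gG; have [Gs Gn G1] := GamP.
suff [b [b1 nb bG]] : exists b, [/\ b != 1, `|b| = 1 &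
    forall (n : int) a, Gam (g *~ n, a) -> b ^ n = a].
  have b0 : b != 0 by rewrite -normr_eq0 nb oner_eq0.
  exists b, [set p | exists y a (n : int), Gam (y, a) /\ p = (y + g *~ n, a * b ^ n)].
  split=> //.
  - split.
    + move=> _ _ [y [a [n [ya ->]]]] [y' [a' [n' [ya' ->]]]].
      exists (y - y'), (a / a'), (n - n'); split; first exact: (Gs (y, a) (y', a')).
      rewrite /= mulrzBr opprD addrACA; congr (_, _).
      by rewrite invfM expfzDr // -invr_expz mulrACA.
    + move=> _ [y [a [n [ya ->]]]] /=; rewrite normrM (Gn _ ya) mul1r.
      by case: n => n; rewrite ?NegzE -?invr_expz ?normfV normrX nb expr1n ?invr1.
    + move=> c [y [a [n [ya [yg ->]]]]].
      have /partial_charN := ya; have -> : - y = g *~ n.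
        by apply/eqP; rewrite -subr_eq0 -opprD -yg oppr0.
      by move=> /bG ->; rewrite divff // (partial_char_neq0 ya).
  - by move=> [y a] ya; exists y, a, 0; rewrite addr0 mulr1.
  - exists 0, 1, 1; split; first exact: partial_char1.
    by rewrite add0r mul1r.
pose ex n := `[< (0 < n)%N /\ exists a, Gam (g *+ n, a) >].
have [exn|nex] := pselect (exists n, ex n); last first.
  exists (-1); split; [|by rewrite normrN1|].
    by rewrite eq_sym -subr_eq0 opprK -mulr2n pnatr_eq0.
  have nexn n a : (0 < n)%N -> ~ Gam (g *+ n, a).
    by move=> n0 gn; apply: nex; exists n; apply/asboolP; split=> //; exists a.
  move=> [[|n]|n] a; first by move=> /G1.
    by move=> /nexn; case.
  rewrite NegzE mulrNz => /partial_charN; rewrite opprK => /nexn; case; done.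
case: (ex_minnP exn) => n0 /asboolP[n0_gt0 [a0 ga0]] n0_min.
have n0_gt1 : (1 < n0)%N.
  rewrite ltn_neqAle n0_gt0 andbT; apply/eqP => n01.
  by apply: (gG a0); rewrite -[g]mulr1n n01.
have [b [bn b1 nb]] := exists_root_neq1 n0_gt1 (Gn _ ga0).
exists b; split=> // n a gna.
have b0 : b != 0 by rewrite -normr_eq0 nb oner_eq0.
have gq : Gam (g *~ ((n %/ n0)%Z * n0), b ^ ((n %/ n0)%Z * n0)).
  rewrite [(_ * _)%R]mulrC mulrzA -exprz_exp; apply: partial_charMz.
  by rewrite -exprnP bn.
have r0 : (n %% n0)%Z = 0.
  have := Gs _ _ gna gq; rewrite /= -mulrzBr [X in _ *~ (X - _)](divz_eq n n0) addrC addKr.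
  have : 0 <= (n %% n0)%Z by rewrite modz_ge0 // eqz_nat -lt0n.
  have : (n %% n0)%Z < n0 by rewrite ltz_pmod.
  case: (n %% n0)%Z => // -[//|r] rn _ gr.
  have := n0_min r.+1; rewrite leqNgt ltz_nat in rn *; rewrite rn => abs; exfalso.
  suff : ex r.+1 by move/abs.
  by apply/asboolP; split=> //; eexists; exact: gr.
have nE : n = (n %/ n0)%Z * n0 by rewrite {1}(divz_eq n n0) r0 addr0.
by apply: (partial_char_inj _ gna); rewrite nE.
Qed.

End PartialChar.

Lemma characters_separate (x0 : G) : x0 != 0 ->
  exists2 gamma, dual_group R G gamma & gamma x0 != 1.
Proof.
move=> x0_neq0.
pose triv : set (G * R[i]) := [set (0, 1)].
have trivP : partial_char triv.
  split=> [_ _ -> ->|_ ->|a [->]] //=; last by rewrite normr1.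
  by rewrite subrr divr1.
have [b0 [Gam0 [b01 Gam0P _ xG0]]] : exists b Gam', [/\ b != 1, partial_char Gam',
    triv `<=` Gam' & Gam' (x0, b)].
  apply: partial_char_extend => //; first by exists (0, 1).
  by move=> a [x00]; move: x0_neq0; rewrite x00 eqxx.
(* The value at [x0] is prescribed only for nonempty graphs, so that the empty chain has an
   admissible union. *)
pose P Gam := partial_char Gam /\ (Gam !=set0 -> Gam (x0, b0)).
have [F FP Ftot|Gam [[GamP Gamx0] Gam_max]] := @Zorn_bigcup _ P.
  have sup2 p q : (\bigcup_(X in F) X) p -> (\bigcup_(X in F) X) q ->
      exists X, [/\ F X, X p & X q].
    move=> [X FX Xp] [Y FY Yq]; have [XY|YX] := Ftot X Y FX FY.
      by exists Y; split=> //; exact: XY.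
    by exists X; split=> //; exact: YX.
  split; last by move=> [p [X FX Xp]]; exists X => //; apply: (FP X FX).2; exists p.
  split.
  - move=> p q /sup2 h /h [X [FX Xp Xq]]; exists X => //.
    by have [[Xs _ _] _] := FP X FX; exact: Xs.
  - by move=> p [X FX Xp]; have [[_ Xn _] _] := FP X FX; exact: Xn.
  - by move=> a [X FX Xa]; have [[_ _ X1] _] := FP X FX; exact: X1.
have Gam_neq0 : Gam !=set0.
  apply: contrapT => Gam0e; apply: (Gam_max Gam0); last by split.
  split; first by move=> p Gp; case: Gam0e; exists p.
  by move=> /(_ _ xG0) Gx; apply: Gam0e; exists (x0, b0).
have total x : exists a, Gam (x, a).
  apply: contrapT => nx.
  have [|b [Gam' [_ Gam'P GG' G'x]]] := partial_char_extend GamP Gam_neq0 (g := x).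
    by move=> a xa; apply: nx; exists a.
  apply: (Gam_max Gam'); last by split=> // _; exact/GG'/Gamx0.
  by split=> // /(_ _ G'x) Gx; apply: nx; exists b.
pose gamma x := projT1 (cid (total x)).
have gammaP x : Gam (x, gamma x) by exact: projT2 (cid (total x)).
exists gamma; last first.
  suff -> : gamma x0 = b0 by [].
  by apply: (partial_char_inj GamP (gammaP x0)); exact: Gamx0.
split=> [x|x y]; first by have [_ Gn _] := GamP; exact: (Gn _ (gammaP x)).
by apply: (partial_char_inj GamP (gammaP _)); exact: partial_charD.
Qed.

End Characters.

(** * Positive semidefiniteness from the bound on Fourier coefficients *)

Section FourierPositivity.
Variables (R : realType) (G : zmodType).
Local Notation Re := (@complex.Re R).

Lemma ReD (x y : R[i]) : Re (x + y) = Re x + Re y.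
Proof. by case: x; case: y. Qed.

Lemma Re_sum (I : Type) (r : seq I) (F : I -> R[i]) :
  Re (\sum_(i <- r) F i) = \sum_(i <- r) Re (F i).
Proof. exact: (big_morph Re ReD). Qed.

Lemma ReZ (a : R) (z : R[i]) : Re (a%:C%C * z) = a * Re z.
Proof. by case: z => x y /=; rewrite mul0r subr0. Qed.

Section Character.
Variable gamma : G -> R[i].
Hypothesis gammaP : dual_group R G gamma.

Lemma character_neq0 x : gamma x != 0.
Proof. by rewrite -normr_eq0 gammaP.1 oner_eq0. Qed.

Lemma character0 : gamma 0 = 1.
Proof.
apply: (mulfI (character_neq0 0)); rewrite mulr1 -gammaP.2.
by rewrite addr0.
Qed.

Lemma characterN x : gamma (- x) = (gamma x)^*.
Proof.
apply: (mulfI (character_neq0 x)); rewrite -gammaP.2 subrr character0.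
by rewrite -normCK gammaP.1 expr1n.
Qed.

Lemma characterB x y : gamma (x - y) = gamma x * (gamma y)^*.
Proof. by rewrite gammaP.2 characterN. Qed.

End Character.

(* Convolving the uniform measures on [1, chi, ..., chi^(N-1)] over characters
   [chi] separating the points from [0] makes the mean small at all of them. *)
Lemma character_mean_small (ys : seq G) (eps : R) : 0 < eps ->
  {in ys, forall y, y != 0} ->
  exists (I : finType) (E : I -> G -> R[i]), [/\ (0 < #|I|)%N,
    forall i, dual_group R G (E i) &
    {in ys, forall y, `|\sum_i E i y| <= (eps * #|I|%:R)%:C%C}].
Proof.
move=> eps0; elim: ys => [_|y ys IHys ys0].
  exists unit, (fun=> fun=> 1); split=> //; first by rewrite card_unit.
  by move=> _; split=> [x|x x']; rewrite ?normr1 ?mulr1.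
have [|I [E [I0 dE smallE]]] := IHys.
  by move=> x xs; apply: ys0; rewrite inE xs orbT.
have [chi [nchi chiM] chiy] := characters_separate R (ys0 y (mem_head _ _)).
pose z := chi y; pose r := Re `|z - 1|.
have rE : `|z - 1| = r%:C%C by rewrite RRe_real // normr_real.
have r0 : 0 < r by rewrite -ltcR -rE normr_gt0 subr_eq0.
(* The geometric sum of the [z ^+ j] has modulus at most [2 / r], and this [N] makes that at most
   [eps * N]. *)
pose N := (Num.truncn (2 / (eps * r))).+1.
have Nbig : 2 <= eps * N%:R * r.
  rewrite mulrAC -ler_pdivrMl ?mulr_gt0 // mulrC.
  exact/ltW/truncnS_gt.
have norm_pow x k : `|chi x ^+ k| = 1 by rewrite normrX nchi expr1n.
exists (I * 'I_N)%type, (fun (ij : I * 'I_N) x => E ij.1 x * chi x ^+ ij.2); split.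
- by rewrite card_prod card_ord muln_gt0 I0.
- move=> [i j]; have [nE EM] := dE i; split=> [x|x x'] /=.
    by rewrite normrM nE norm_pow mul1r.
  by rewrite EM chiM exprMn mulrACA.
have sumE x : \sum_(ij : I * 'I_N) E ij.1 x * chi x ^+ ij.2 =
    (\sum_i E i x) * \sum_(j < N) chi x ^+ j.
  rewrite -(pair_bigA _ (fun i (j : 'I_N) => E i x * chi x ^+ j)) /= big_distrl /=.
  by apply: eq_bigr => i _; rewrite big_distrr.
have sum_le1 (J : finType) (f : J -> R[i]) : (forall j, `|f j| = 1) ->
    `|\sum_j f j| <= #|J|%:R.
  move=> f1; apply: le_trans (ler_norm_sum _ _ _) _.
  by under eq_bigr do rewrite f1; rewrite sumr_const.
have sum_chi : `|\sum_(j < N) z ^+ j| <= (eps * N%:R)%:C%C.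
  have := subrX1 z N; move=> /(congr1 Num.norm); rewrite normrM rE => zN.
  have : r%:C%C * `|\sum_(j < N) z ^+ j| <= 2.
    rewrite -zN; apply: le_trans (ler_normB _ _) _.
    by rewrite norm_pow normr1.
  rewrite mulrC -ler_pdivlMr ?ltcR // => /le_trans; apply.
  rewrite ler_pdivrMr ?ltcR // -rmorphM /=.
  by rewrite (_ : 2 = (2 : R)%:C%C) ?lecR // rmorph_nat.
move=> x; rewrite inE sumE normrM card_prod card_ord natrM => /orP[/eqP->|xs].
  rewrite mulrCA rmorphM rmorph_nat /=; apply: ler_pM => //.
  by apply: sum_le1 => i; apply: (dE i).1.
rewrite mulrA rmorphM /= rmorph_nat; apply: ler_pM => //; first exact: smallE.
by rewrite (le_trans (sum_le1 _ _ _)) ?card_ord.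
Qed.

(** A finite substitute for integrating over the dual group: averaging over the characters of
    [character_mean_small] preserves the mass at 0 and leaves an error of at most [eps * t] from the
    other points. If [s < 0], the chosen [eps] gives [s + eps * t = - eps < 0]. *)
Lemma mass_at_0_ge0 (L : seq (R * G)) :
  (forall gamma, dual_group R G gamma ->
    0 <= Re (\sum_(p <- L) p.1%:C%C * gamma p.2)) ->
  0 <= \sum_(p <- L) p.1 * (p.2 == 0)%:R.
Proof.
move=> Lpos; rewrite leNgt; apply/negP; set s := \sum_(p <- L) _ => s_lt0.
pose t := \sum_(p <- L) `|p.1|.
have t0 : 0 <= t by apply: sumr_ge0.
pose eps := - s / (t + 1).
have eps0 : 0 < eps by rewrite divr_gt0 ?oppr_gt0 // ltr_wpDl.
have [|I [E [I0 dE smallE]]] := @character_mean_small [seq p.2 | p <- L & p.2 != 0] eps eps0.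
  by move=> _ /mapP[p + ->]; rewrite mem_filter => /andP[].
have : 0 <= \sum_i Re (\sum_(p <- L) p.1%:C%C * E i p.2).
  by apply: sumr_ge0 => i _; exact: Lpos.
under eq_bigr do rewrite Re_sum.
rewrite exchange_big /= leNgt => /negP; apply.
apply: (@le_lt_trans _ _ (#|I|%:R * (s + eps * t))).
  rewrite mulrDr mulrCA !mulr_sumr -big_split /= !big_seq; apply: ler_sum => p pL.
  rewrite -Re_sum -mulr_sumr ReZ.
  have [p0|p0] := eqVneq p.2 0.
    rewrite (eq_bigr (fun=> 1)); last by move=> i _; rewrite p0 (character0 (dE i)).
    rewrite sumr_const (_ : 1 *+ #|I| = (#|I|%:R : R)%:C%C); last by rewrite rmorph_nat.
    rewrite /= mulr1 mulrC lerDl.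
    exact: mulr_ge0 (ltW eps0) (mulr_ge0 (ler0n _ _) (normr_ge0 _)).
  rewrite mulr0 mulr0 add0r; apply: le_trans (ler_norm _) _; rewrite normrM.
  rewrite [X in _ <= X]mulrA [X in X <= _]mulrC ler_wpM2r //.
  have /smallE : p.2 \in [seq p.2 | p <- L & p.2 != 0] by rewrite map_f // mem_filter p0.
  by rewrite -lecR => h; apply: le_trans (normc_ge_Re _) h.
have epsE : eps * t + eps = - s.
  by rewrite -[in X in _ + X](mulr1 eps) -mulrDr divfK // gt_eqF // ltr_wpDl.
by rewrite pmulr_rlt0 ?ltr0n //; lra.
Qed.

Lemma MG_upper (A : {fset G}) gamma : dual_group R G gamma ->
  - Re (fourier_indic A gamma) <= MG R A.
Proof.
move=> gammaP; apply: ub_le_sup; last by exists gamma.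
exists (\sum_(x <- A) 1) => _ [chi [nchi _] <-].
apply: le_trans (ler_norm _) _; rewrite normrN -lecR; apply: le_trans (normc_ge_Re _) _.
apply: le_trans (ler_norm_sum _ _ _) _.
rewrite rmorph_sum /=; apply: ler_sum => x _.
by rewrite norm_conjC nchi.
Qed.

(** The form is the mass at 0 of the measure [L], whose transform at [gamma] is [|S|^2] times the
    Fourier coefficient of [A] plus [c], hence has nonnegative real part. *)
Lemma indic_form_ge0 (A : {fset G}) (c : R) (s : seq (R * G)) : MG R A <= c ->
  0 <= \sum_(p <- s) \sum_(q <- s)
    p.1 * q.1 * ((p.2 - q.2 \in A)%:R + c * (p.2 == q.2)%:R).
Proof.
move=> MGc.
pose ss := [seq (p.1 * q.1, p.2 - q.2) | p <- s, q <- s].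
pose L := [seq (w.1, w.2 - a) | w <- ss, a <- A] ++ [seq (c * w.1, w.2) | w <- ss].
have := @mass_at_0_ge0 L.
rewrite /L !big_cat /= !big_allpairs_dep /= big_map !big_allpairs_dep /= -big_split /=.
move=> LP.
rewrite [X in 0 <= X](_ : _ = \sum_(p <- s)
    (\sum_(q <- s) \sum_(a <- A) p.1 * q.1 * (p.2 - q.2 - a == 0)%:R
  + \sum_(q <- s) c * (p.1 * q.1) * (p.2 - q.2 == 0)%:R)); last first.
  apply: eq_bigr => p _; rewrite -big_split /=; apply: eq_bigr => q _.
  rewrite mulrDr -mulr_sumr mulrCA mulrA subr_eq0; congr (_ * _ + _).
  rewrite -natr_sum; congr (_%:R).
  rewrite sum_nat_of_bool -(count_uniq_mem _ (fset_uniq A)); apply: eq_count => a /=.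
  by rewrite subr_eq0 eq_sym.
apply: LP => gamma gammaP.
rewrite big_cat /= !big_allpairs_dep /= big_map !big_allpairs_dep /=.
pose S := \sum_(p <- s) p.1%:C%C * gamma p.2.
have SE : S * S^* = \sum_(p <- s) \sum_(q <- s) (p.1 * q.1)%:C%C * gamma (p.2 - q.2).
  rewrite /S big_distrl /=; apply: eq_bigr => p _.
  rewrite rmorph_sum big_distrr /=; apply: eq_bigr => q _.
  by rewrite rmorphM characterB // rmorphM /= conj_Creal ?complex_real // mulrACA.
rewrite [X in Re X](_ : _ = S * S^* * (fourier_indic A gamma + c%:C%C)); last first.
  rewrite mulrDr SE !mulr_suml; congr (_ + _); apply: eq_bigr => p _;
    rewrite mulr_suml; apply: eq_bigr => q _.
  - rewrite /fourier_indic mulr_sumr; apply: eq_bigr => a _ /=.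
    by rewrite (characterB gammaP (p.2 - q.2)) mulrA.
  - by rewrite /= [(c * _)%:C%C]rmorphM /= -[LHS]mulrA [RHS]mulrC.
rewrite -normCK -add_Re2_Im2 ReZ mulr_ge0 ?addr_ge0 ?sqr_ge0 // ReD /=.
have := MG_upper A gammaP; lra.
Qed.

End FourierPositivity.

(** * The theorem *)

Lemma shift_form_nonneg_MG (R : realType) (G : zmodType) (A : {fset G}) (e : nat) :
  MG R A <= e%:R -> shift_form_nonneg (0 |` A)%fset e.
Proof.
move=> Me I.
(* Inserting 0 into [A] raises the diagonal by one exactly when [0 \notin A]; [c] compensates for
   this. *)
pose c : R := e%:R + (0 \notin A)%:R.
have Mc : MG R A <= c by rewrite (le_trans Me) // lerDl.
pose s := flatten [seq [seq (i.1%:~R : R, x) | x <- i.2] | i <- I].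
rewrite -(ler0z R) (le_trans (indic_form_ge0 s Mc)) // /s big_flatten big_map le_eqVlt.
apply/orP; left; apply/eqP; rewrite rmorph_sum /=; apply: eq_bigr => i _.
rewrite big_map rmorph_sum /=.
under eq_bigr do rewrite big_flatten big_map.
rewrite exchange_big /=; apply: eq_bigr => j _.
rewrite 2!rmorphM /= /shift_form -pmulrn natr_sum mulr_sumr; apply: eq_bigr => x _.
rewrite big_map natr_sum mulr_sumr; apply: eq_bigr => y _ /=; congr (_ * _).
rewrite natrD natrM !inE subr_eq0 /c; have [->|_] := eqVneq x y.
  by rewrite subrr; case: (0 \in A); rewrite /= ?mulr1 ?addr0 // add0r addrC.
by rewrite !mulr0 !addr0.
Qed.

Lemma MG_small_zmod_closed (R : realType) (G : zmodType) (A : {fset G}) :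
  A != fset0 -> {in A, forall x : G, - x \in A} -> MG R A < 2 / 5 ->
  zmod_closed (mem [set` A]).
Proof.
move=> /fset0Pn[a0 a0A] AN M_small; pose c := MG R A.
have form s := @indic_form_ge0 R G A c s (lexx _).
have A0 : 0 \in A.
  apply/negPn/negP => nA0; have a0_neq0 : a0 != 0 by apply: contraNneq nA0 => <-.
  (* A loopless edge has eigenvalue [-1], which forces [c >= 1]. *)
  have := form [:: (1, 0); (-1, a0)]; rewrite !big_cons !big_nil /= !subrr !eqxx.
  rewrite sub0r subr0 AN // a0A (negbTE nA0) (eq_sym 0) (negbTE a0_neq0) /= -/c in M_small *.
  by lra.
split=> [|a b]; rewrite !inE //= => aA bA; apply/negPn/negP => abA.
have neq x y : x \in A -> x - y \notin A -> x != y.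
  by move=> xA xyA; apply: contraNneq xyA => ->; rewrite subrr.
have ab := neq a b aA abA.
have a_neq0 : a != 0.
  by apply: contraNneq abA => ->; rewrite sub0r AN.
have b_neq0 : b != 0 by apply: contraNneq abA => ->; rewrite subr0.
have baA : b - a \notin A by apply: contra abA => /AN; rewrite opprB.
(* The path [a - 0 - b] has smallest eigenvalue [- sqrt 2], and [sqrt 2 > 7 / 5]. *)
have := form [:: (-3, 0); (2, a); (2, b)]; rewrite !big_cons !big_nil /= !subrr !eqxx.
rewrite !sub0r !subr0 !AN // aA bA A0 (negbTE abA) (negbTE baA).
rewrite !(eq_sym 0) (negbTE a_neq0) (negbTE b_neq0) (negbTE ab) (eq_sym b) (negbTE ab)
  /= -/c in M_small *.
by lra.
Qed.

(** The three terms count the point 0, the points of [B] outside all stabilisers, and the points of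
    the stabilisers outside [B]. *)
Lemma symdiff_size_bound (e : nat) : (0 < e)%N ->
  (1 + 2 ^ (clique_order e + (e.+1 ^ 2).+1) +
    2 * e.+1 * 2 ^ (slack e + (e.+1 ^ 2).+1) <= 2 ^ (2 * e.+1) ^ 4)%N.
Proof.
rewrite -(ltn_add2r 1) !addn1 /slack /clique_order; move: e.+1 => d d2.
have d0 : (4 <= d ^ 2)%N by rewrite -[4%N]/(2 ^ 2)%N leq_exp2r.
have d4 : (4 * d ^ 2 <= d ^ 4)%N.
  have -> : (d ^ 4 = d ^ 2 * d ^ 2)%N by rewrite -expnD.
  by rewrite leq_mul2r d0 orbT.
have b1 : (2 ^ (10 * d ^ 4 + (d ^ 2).+1) <= 2 ^ (12 * d ^ 4))%N by rewrite leq_exp2l //; lia.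
have b2 : (2 * d * 2 ^ (2 * d ^ 2 + (d ^ 2).+1) <= 2 ^ (12 * d ^ 4))%N.
  apply: (@leq_trans (2 ^ (d.+1 + (2 * d ^ 2 + (d ^ 2).+1)))%N).
    rewrite [X in (_ <= X)%N]expnD; apply: leq_mul (leqnn _).
    by rewrite expnS leq_mul2l /=; exact/ltnW/ltn_expl.
  have dd : (d <= d ^ 2)%N by rewrite leq_pmulr // ltnW.
  by rewrite leq_exp2l //; lia.
have b3 : (1 <= 2 ^ (12 * d ^ 4))%N by rewrite expn_gt0.
apply: leq_trans (leq_add (leq_add b3 b1) b2) _.
apply: (@leq_trans (2 ^ (12 * d ^ 4 + 2))%N); first by rewrite expnD; lia.
by rewrite leq_exp2l // expnMn; lia.
Qed.

Lemma exists_subgroups_close (R : realType) (G : zmodType) (A : {fset G}) (e : nat) :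
  {in A, forall x : G, - x \in A} -> (0 < e)%N -> MG R A <= e%:R ->
  exists HH : {fset (set G)},
    let U : set G := \bigcup_(H in [set` HH]) H in
    [/\ forall H : set G, H \in HH -> zmod_closed (mem H),
        (#|` HH| <= 2 * e.+1)%N,
        finite_set ([set` A] `+` U) &
        (#|` fset_set ([set` A] `+` U)| <= 2 ^ (2 * e.+1) ^ 4)%N].
Proof.
move=> AN e0 Me; pose B := (0 |` A)%fset.
have Bpos := shift_form_nonneg_MG Me.
have B0 : 0 \in B by rewrite !inE eqxx.
have BN : {in B, forall x, - x \in B}.
  by move=> x; rewrite !inE oppr_eq0 => /orP[->//|/AN->]; rewrite orbT.
have [cs [szcs csP cs_cover]] := clique_stab_cover B0 BN Bpos e0.
have [N0N _] := slack_clique_order e0.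
pose stab := clique_stab B (slack e).
have {}csP C : C \in cs -> [/\ clique B C, 0 \in C & (slack e * slack e + 2 * slack e <= size C)%N].
  by move=> /csP[cC C0 ->].
have joinedH C h : C \in cs -> stab C h -> clique_joined B (slack e) C h.
  move=> /csP[cC C0 szC]; apply: (joined_clique_stab B0 BN Bpos e0) => //.
  exact: (allP (clique_equiv_refl _ cC)).
pose HH := [fset H in [seq stab C | C <- cs]]%fset.
have UE x : (\bigcup_(H in [set` HH]) H) x <-> exists2 C, C \in cs & stab C x.
  split=> [[H]|[C Ccs Cx]].
    by rewrite /= inE => /mapP[C Ccs ->] Cx; exists C.
  by exists (stab C) => //; rewrite /= inE; apply: map_f.
exists HH => U.
(* Each [h] in a stabiliser is adjacent to some [c] in [C], so it lies in the finite sumset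
   [B + C]. *)
have finU : finite_set U.
  apply: bigcup_finite => [|H]; first exact: finite_fset.
  rewrite /= inE => /mapP[C Ccs ->]; have [cC C0 szC] := csP C Ccs.
  apply: sub_finite_set (finite_seq [seq b + c | b <- B, c <- C]) => h /(joinedH C h Ccs) hC.
  have : has (fun c => h - c \in B) C.
    rewrite has_count -size_filter; apply: size_filter_compl (ltnW hC) _.
    have m0 : (0 < slack e)%N by rewrite muln_gt0 expn_gt0.
    by apply: leq_trans szC; lia.
  move=> /hasP[c cC' hcB] /=; apply/allpairsP; exists (h - c, c); split=> //=.
  by rewrite subrK.
have finX : finite_set ([set` A] `+` U).
  by rewrite setY_def finite_setU; split; apply: finite_setD => //; exact: finite_fset.
split=> //.
- move=> H; rewrite inE => /mapP[C Ccs ->]; have [cC C0 szC] := csP C Ccs.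
  exact: (clique_stab_zmod_closed B0 BN Bpos e0).
- by rewrite card_fseq (leq_trans (size_undup _)) // size_map.
set F := fset_set _.
have FP x : x \in F -> (x \in A /\ ~ U x) \/ (U x /\ x \notin A).
  rewrite in_fset_set // inE setY_def => -[[xA Ux]|[Ux xA]]; [left|right]; split=> //.
  exact/negP.
apply: leq_trans (symdiff_size_bound e0).
(* [P1] absorbs the only point at which [A] and [B] can differ. *)
pose P1 x := x == 0 :> G.
pose P2 x := (x \in B) && ~~ has (fun C => `[< stab C x >]) cs.
pose P3 x := has (fun C => `[< stab C x >] && (x \notin B)) cs.
have sz1 : (count P1 F <= 1)%N by rewrite count_uniq_mem ?leq_b1 ?fset_uniq.
have sz2 : (count P2 F <= 2 ^ (clique_order e + (e.+1 ^ 2).+1))%N.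
  rewrite -size_filter ltnW // cs_cover ?filter_uniq ?fset_uniq // => x.
  rewrite mem_filter => /andP[/andP[xB /hasPn xcs] _]; split=> // C /xcs /asboolP.
  by [].
have sz3 : (count P3 F <= 2 * e.+1 * 2 ^ (slack e + (e.+1 ^ 2).+1))%N.
  apply: leq_trans (_ : _ <= size cs * 2 ^ (slack e + (e.+1 ^ 2).+1))%N _;
    last by rewrite leq_mul2r szcs orbT.
  apply: count_has_le => C Ccs; have [cC C0 szC] := csP C Ccs.
  rewrite -size_filter ltnW // (joined_far_bound B0 BN Bpos e0 cC szC C0)
    ?filter_uniq ?fset_uniq // => x.
  by rewrite mem_filter => /andP[/andP[/asboolP /(joinedH C x Ccs)]].
apply: leq_trans (leq_add (leq_add sz1 sz2) sz3).
have -> : size F = count (predU (predU P1 P2) P3) F.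
  apply/esym/eqP; rewrite -all_count; apply/allP => x /FP xF /=.
  have [->//|x0] := eqVneq x 0; first by rewrite /P1 eqxx.
  rewrite /P1 (negbTE x0) /P2 /P3 !inE (negbTE x0) /=.
  case: xF => [[xA Ux]|[/UE[C Ccs Cx] xA]].
    rewrite xA /=; apply/orP; left; apply/hasPn => C Ccs; apply/asboolP => Cx.
    by apply: Ux; apply/UE; exists C.
  rewrite (negbTE xA) /=; apply/hasP; exists C => //; rewrite andbT.
  exact/asboolP.
apply: leq_trans (_ : _ <= count (predU P1 P2) F + count P3 F)%N _.
  by rewrite -count_predUI leq_addr.
by rewrite leq_add2r -count_predUI leq_addr.
Qed.

Theorem theorem1p4 (R : realType) :
  exists c C : R, [/\ 0 < c, 0 < C &
    forall (G : zmodType) (A : {fset G}),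
      A != fset0 -> {in A, forall x : G, - x \in A} ->
      exists HH : {fset (set G)},
        let U : set G := \bigcup_(H in [set` HH]) H in
        [/\ forall H : set G, H \in HH -> zmod_closed (mem H),
            (#|` HH|)%:R <= C * Num.max 1 (MG R A),
            finite_set ([set` A] `+` U) &
            [set` A] = U \/
            MG R A >= c * (ln ((#|` fset_set ([set` A] `+` U)|)%:R)) `^ c]].
Proof.
(* With [M] for [MG R A] and [e <= M + 1], the number of subgroups is at most
   [2 * (M + 2) <= 6 * max(1, M)]. The same quantity is at most [12 * M] exactly when [M >= 2 / 5],
   hence the case split. As an exponent, [1 / 12] is below the [1 / 4] required by
   [ln D <= k ^+ 4]. *)
exists 12^-1, 6; split=> [||G A A_neq0 AN]; rewrite ?invr_gt0 //.
have [M_small|M_large] := ltP (MG R A) (2 / 5).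
  exists [fset [set` A]]%fset; rewrite set_fset1 bigcup_set1; split.
  - by move=> H; rewrite inE => /eqP->; exact: MG_small_zmod_closed AN M_small.
  - by rewrite cardfs1 (le_trans (_ : 1 <= 6 * 1)) ?ler_pM2l ?le_max ?lexx //; lra.
  - by rewrite setY_def !setDv setU0.
  - by left.
pose e := (Num.truncn (MG R A)).+1.
have M0 : 0 <= MG R A by lra.
have Me : MG R A <= e%:R by exact/ltW/truncnS_gt.
have eM : e%:R <= MG R A + 1 by rewrite /e -natr1 lerD2r truncn_le.
have [HH [HHP szHH finX szX]] := exists_subgroups_close AN (ltn0Sn _ : (0 < e)%N) Me.
exists HH; split=> //.
  have : (#|` HH|)%:R <= (2 * e.+1)%N%:R :> R by rewrite ler_nat.
  move=> /le_trans; apply; rewrite natrM -[e.+1]addn1 natrD.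
  by have [M1|M1] := leP 1 (MG R A); lra.
right; move: szX; set D := #|` _|.
move=> szX; pose k : R := (2 * e.+1)%N%:R.
have k1 : 1 <= k by rewrite ler1n.
have lnD : 0 <= ln (D%:R : R) <= k ^+ 4.
  (* For [D = 0] the default value [ln 0 = 0] satisfies the bound. *)
  have [->|D0] := posnP D; first by rewrite ln0 // lexx exprn_ge0 // (le_trans ler01).
  apply/andP; split; first by rewrite ln_ge0 // ler1n.
  rewrite -[k ^+ 4]expRK ler_ln ?posrE ?ltr0n ?expR_gt0 //.
  apply: (@le_trans _ _ ((2 ^ (2 * e.+1) ^ 4)%N%:R)); first by rewrite ler_nat.
  have -> : k ^+ 4 = 1 * ((2 * e.+1) ^ 4)%N%:R :> R by rewrite mul1r natrX.
  rewrite mulrC expRM_natl natrX lerXn2r ?nnegrE ?ler0n ?expR_ge0 //.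
  exact: le_trans (expR_ge1Dx 1).
move: lnD => /andP[lnD0 lnDk].
apply: (@le_trans _ _ (12^-1 * k)).
  rewrite ler_pM2l ?invr_gt0 //.
  apply: (@le_trans _ _ ((k ^+ 4) `^ 12^-1)).
    by apply: ge0_ler_powR; rewrite ?nnegrE ?invr_ge0 // exprn_ge0 // (le_trans ler01).
  rewrite -powR_mulrn ?(le_trans ler01) // -powRrM -[X in _ <= X]powRr1 ?(le_trans ler01) //.
  by apply: ler_powR => //; rewrite ler_pdivrMr ?mul1r ?ler_nat.
by rewrite /k natrM -[e.+1]addn1 natrD; lra.
Qed.
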